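(* Consider a strip-plot design with $B\ge 2$ blocks, each a $P\times Q$ array of units, $P,Q\ge 2$, with potential outcomes $Y_b(rc;pq)$, observed outcomes $Y_b^{\rm obs}(pq)$, and quantities $M_b^{\rm row}$, $M_b^{\rm col}$, $M_b^{\rm rowcol}$ as defined in the context. Then for $1\le b\le B$, $1\le p_1,p_2\le P$ and $1\le q_1,q_2\le Q$, $$\operatorname{cov}\{Y_b^{\rm obs}(p_1q_1),Y_b^{\rm obs}(p_2q_2)\}=\frac{1}{PQ}\Big[\{P\delta(p_1,p_2)-1\}M_b^{\rm row}(p_1q_1,p_2q_2)+\{Q\delta(q_1,q_2)-1\}M_b^{\rm col}(p_1q_1,p_2q_2)+\{P\delta(p_1,p_2)-1\}\{Q\delta(q_1,q_2)-1\}M_b^{\rm rowcol}(p_1q_1,p_2q_2)\Big],$$ where $\delta(\cdot,\cdot)$ is the Kronecker delta.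
   Context: Setup. Factors $F$ and $G$ have levels $1,\dots,P$ and $1,\dots,Q$ respectively ($P,Q\ge 2$); the treatment combinations are $pq$, $1\le p\le P$, $1\le q\le Q$. There are $BPQ$ experimental units arranged in $B\ge 2$ blocks, each block being a $P\times Q$ array of units (rows $r=1,\dots,P$, columns $c=1,\dots,Q$). Strip-plot randomization: independently for each block $b$, and independently for rows and columns within each block, the levels $1,\dots,P$ of $F$ are assigned to the $P$ rows by a uniformly random permutation (one row per level), and the levels $1,\dots,Q$ of $G$ are assigned to the $Q$ columns by a uniformly random permutation (one column per level). The unit in block $b$ assigned to treatment combination $pq$ is the one whose row is assigned to level $p$ of $F$ and whose column is assigned to level $q$ of $G$. Potential outcomes: $Y_b(rc;pq)$ is a fixed (nonrandom) real number, the outcome of the unit at row $r$ and column $c$ of block $b$ when exposed to treatment combination $pq$. All randomness comes from the randomization; covariances are with respect to it. $Y_b^{\rm obs}(pq)$ denotes the outcome observed in block $b$ from the unit assigned to $pq$, i.e. $Y_b^{\rm obs}(pq)=Y_b(rc;pq)$ with $r$, $c$ the (random) row and column in block $b$ assigned to level $p$ of $F$ and level $q$ of $G$. Definitions: $\bar Y_b(pq)=\frac{1}{PQ}\sum_{r=1}^P\sum_{c=1}^Q Y_b(rc;pq)$, $\bar Y_b(r\bullet;pq)=\frac1Q\sum_{c=1}^Q Y_b(rc;pq)$, $\bar Y_b(\bullet c;pq)=\frac1P\sum_{r=1}^P Y_b(rc;pq)$, and $$M_b^{\rm row}(p_1q_1,p_2q_2)=\frac{Q}{P-1}\sum_{r=1}^P\{\bar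 Y_b(r\bullet;p_1q_1)-\bar Y_b(p_1q_1)\}\{\bar Y_b(r\bullet;p_2q_2)-\bar Y_b(p_2q_2)\},$$ $$M_b^{\rm col}(p_1q_1,p_2q_2)=\frac{P}{Q-1}\sum_{c=1}^Q\{\bar Y_b(\bullet c;p_1q_1)-\bar Y_b(p_1q_1)\}\{\bar Y_b(\bullet c;p_2q_2)-\bar Y_b(p_2q_2)\},$$ $$M_b^{\rm rowcol}(p_1q_1,p_2q_2)=\frac{1}{(P-1)(Q-1)}\sum_{r=1}^P\sum_{c=1}^Q D_b(rc;p_1q_1)\,D_b(rc;p_2q_2),$$ where $D_b(rc;pq)=Y_b(rc;pq)-\bar Y_b(r\bullet;pq)-\bar Y_b(\bullet c;pq)+\bar Y_b(pq)$. *)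

(* Defs.v *)
From mathcomp Require Import all_boot all_order all_algebra all_fingroup.
From mathcomp Require Import all_classical all_reals all_analysis.

Set Implicit Arguments.
Unset Strict Implicit.
Unset Printing Implicit Defensive.
Import Order.TTheory GRing.Theory Num.Theory.
Import numFieldNormedType.Exports.

Local Open Scope classical_set_scope.
Local Open Scope ring_scope.

(** Strip-plot design: [B] blocks, each a [P] x [Q] array of units, factors
    with [P] and [Q] levels.  Blocks, rows, columns and levels are numbered
    from 0.  [Y b r c p q] is the outcome of the unit in row [r] and column [c]
    of block [b] when exposed to the treatment combination [p q]. *)
Definition outcomes (R : realType) (B P Q : nat) :=
  'I_B -> 'I_P -> 'I_Q -> 'I_P -> 'I_Q -> R.

Section PotentialOutcomes.
Context (R : realType) (B P Q : nat) (Y : outcomes R B P Q) (b : 'I_B).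
Implicit Types (r p : 'I_P) (c q : 'I_Q).

Definition Ybar p q : R :=
  (P%:R * Q%:R)^-1 * \sum_(r < P) \sum_(c < Q) Y b r c p q.

Definition Ybar_row r p q : R := Q%:R^-1 * \sum_(c < Q) Y b r c p q.

Definition Ybar_col c p q : R := P%:R^-1 * \sum_(r < P) Y b r c p q.

Definition D r c p q : R :=
  Y b r c p q - Ybar_row r p q - Ybar_col c p q + Ybar p q.

Definition M_row p1 q1 p2 q2 : R :=
  Q%:R / (P%:R - 1) *
  \sum_(r < P) (Ybar_row r p1 q1 - Ybar p1 q1) *
               (Ybar_row r p2 q2 - Ybar p2 q2).

Definition M_col p1 q1 p2 q2 : R :=
  P%:R / (Q%:R - 1) *
  \sum_(c < Q) (Ybar_col c p1 q1 - Ybar p1 q1) *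
               (Ybar_col c p2 q2 - Ybar p2 q2).

Definition M_rowcol p1 q1 p2 q2 : R :=
  ((P%:R - 1) * (Q%:R - 1))^-1 *
  \sum_(r < P) \sum_(c < Q) D r c p1 q1 * D r c p2 q2.

End PotentialOutcomes.

Section Randomization.
Context d (Omega : measurableType d) (R : realType) (Pr : probability Omega R).

Record uniformly_distributed (S : finType) (X : Omega -> S) : Prop := {
  uniform_measurable : forall s : S, measurable (X @^-1` [set s]);
  uniform_mass : forall s : S, Pr (X @^-1` [set s]) = (#|S|%:R^-1)%:E }.

(** [rho b w p] is the row of block [b] assigned to level [p] of the first
    factor, [kappa b w q] the column assigned to level [q] of the second.  The
    last field is the mutual independence of the whole family of [2 B] random
    permutations; the product rule for a subfamily is obtained by taking the
    other sets to be [setT]. *)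
Record strip_plot_randomization (B P Q : nat)
    (rho : 'I_B -> Omega -> 'S_P) (kappa : 'I_B -> Omega -> 'S_Q) : Prop := {
  rho_uniform : forall b, uniformly_distributed (rho b);
  kappa_uniform : forall b, uniformly_distributed (kappa b);
  rho_kappa_independent :
    forall (A : 'I_B -> set 'S_P) (C : 'I_B -> set 'S_Q),
      Pr (\bigcap_(b in [set: 'I_B])
            (rho b @^-1` A b `&` kappa b @^-1` C b)) =
      (\prod_(b < B) (Pr (rho b @^-1` A b) * Pr (kappa b @^-1` C b)))%E }.

End Randomization.

Definition Yobs (Omega : Type) (R : realType) (B P Q : nat)
    (Y : outcomes R B P Q)
    (rho : 'I_B -> Omega -> 'S_P) (kappa : 'I_B -> Omega -> 'S_Q)
    (b : 'I_B) (p : 'I_P) (q : 'I_Q) : Omega -> R :=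
  fun w => Y b (rho b w p) (kappa b w q) p q.

Definition kronecker (R : realType) (n : nat) (i j : 'I_n) : R := (i == j)%:R.

(* Main.v *)
Require Import Defs.
From mathcomp Require Import all_boot all_order all_algebra all_fingroup.
From mathcomp Require Import all_classical all_reals all_analysis.
From mathcomp Require Import ring.

(** The covariance only involves the two permutations of block [b], and these
    form a single random variable that is uniform on ['S_P * 'S_Q].  Hence the
    covariance is an ordinary average over pairs of permutations
    ([uniform_covariance], [block_uniform]), and the problem becomes one of
    finite sums.

    Write [F] and [G] for the arrays of outcomes under [p1 q1] and [p2 q2],
    centred at their means.  The covariance is the mean of
    [F (s p1) (t q1) * G (s p2) (t q2)] over [s] and [t].  For a uniform
    permutation [s], the pair [(s p1, s p2)] is uniform on the diagonal when
    [p1 = p2] and uniform off the diagonal otherwise; [mean_perm2] covers both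
    cases by one formula that is affine in the Kronecker delta.  Using it for
    rows and for columns expresses the covariance through three sums
    ([mean_perm_pair]): the sum of the products [F r c * G r c] over the units,
    that of the products of row totals, and that of the products of column
    totals.  The product of the grand totals, which would be a fourth term, is
    zero because [F] is centred.

    The totals give the row and column terms directly, and the analysis of
    variance identity [interaction_sum] trades the sum over units for
    [M_rowcol] plus row and column terms.  Up to a common factor, the row term
    receives [(P * dp - 1) * (Q * dq - 1)] from the sum over units and
    [(P * dp - 1) * (Q - Q * dq)] from the row totals, where [dp] and [dq] are
    the two Kronecker deltas.  These add up to [(P * dp - 1) * (Q - 1)], so that
    [q1] and [q2] drop out of the coefficient of [M_row]; columns are
    symmetric. *)

Import GRing.Theory Num.Theory.

Local Open Scope classical_set_scope.
Local Open Scope ring_scope.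

(** * Averages over uniform permutations *)

Definition mean {R : realType} {S : finType} (f : S -> R) : R :=
  #|S|%:R^-1 * \sum_s f s.

Lemma eq_mean {R : realType} {S : finType} (f g : S -> R) :
  f =1 g -> mean f = mean g.
Proof. by move=> fg; rewrite /mean (eq_bigr _ (fun s _ => fg s)). Qed.

Lemma mean_pair {R : realType} {S T : finType} (f : S -> T -> R) :
  mean (fun x : S * T => f x.1 x.2) = mean (fun s => mean (f s)).
Proof.
rewrite /mean card_prod natrM invfM -mulrA; congr (_ * _).
by rewrite -mulr_sumr -(pair_bigA _ f).
Qed.

(** Composing [s] with a transposition of [p] and [p'] shows that the mean does
    not depend on [p]; averaging it over [p] first turns it into the mean of
    [u]. *)
Lemma mean_perm1 {R : realType} {T : finType} (u : T -> R) (p : T) :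
  mean (fun s : {perm T} => u (s p)) = mean u.
Proof.
have T0 : #|T|%:R != 0 :> R.
  by rewrite pnatr_eq0 -lt0n; apply/card_gt0P; exists p.
have S0 : #|{perm T}|%:R != 0 :> R.
  by rewrite pnatr_eq0 -lt0n; apply/card_gt0P; exists 1%g.
have shift (p' : T) :
    \sum_(s : {perm T}) u (s p') = \sum_(s : {perm T}) u (s p).
  rewrite (reindex_inj (mulgI (tperm p p'))) /=.
  by apply: eq_bigr => s _; rewrite permM tpermR.
apply: (mulfI T0); apply: (mulfI S0); rewrite /mean mulrCA mulVKf// mulVKf//.
rewrite mulr_natl -sumr_const -(eq_bigr _ (fun p' _ => shift p')).
rewrite exchange_big /= mulr_natl -sumr_const; apply: eq_bigr => s _.
by rewrite [RHS](reindex_inj (@perm_inj _ s)).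
Qed.

(** The two values of the delta give [h] averaged over the diagonal and over the
    complement of the diagonal.  The form is affine in the delta so that it can
    be applied to rows and columns without splitting cases. *)
Lemma mean_perm2 {R : realType} {T : finType} (h : T -> T -> R) (p1 p2 : T) :
  (1 < #|T|)%N ->
  mean (fun s : {perm T} => h (s p1) (s p2)) =
  (#|T|%:R * (#|T|%:R - 1))^-1 *
  ((#|T|%:R * (p1 == p2)%:R - 1) * \sum_r h r r
   + (1 - (p1 == p2)%:R) * \sum_r \sum_r' h r r').
Proof.
move=> T1.
have T0 : #|T|%:R != 0 :> R by rewrite pnatr_eq0 -lt0n ltnW.
have T10 : #|T|%:R - 1 != 0 :> R by rewrite subr_eq0 pnatr_eq1 gtn_eqF.
have [<-|p12] := eqVneq p1 p2.
  by rewrite (mean_perm1 (fun r => h r r)) /mean /=; field; rewrite T0 T10.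
(* A transposition that fixes p1 moves p2 to any other level, so the mean may
   also be averaged over all levels other than p1 in the place of p2. *)
have shift (p' : T) : p' != p1 ->
    \sum_(s : {perm T}) h (s p1) (s p') = \sum_(s : {perm T}) h (s p1) (s p2).
  move=> p'1; rewrite (reindex_inj (mulgI (tperm p' p2))) /=.
  apply: eq_bigr => s _; rewrite !permM tpermL tpermD//.
  by rewrite eq_sym.
have cardT : #|[pred p' | p' != p1]| = #|T|.-1.
  by rewrite -(cardC1 p1); apply: eq_card => x; rewrite !inE.
have natT : (#|T|.-1)%:R = #|T|%:R - 1 :> R.
  by rewrite -[in RHS](prednK (ltnW T1)) -natr1 addrK.
have key : (#|T|%:R - 1) * mean (fun s : {perm T} => h (s p1) (s p2)) =
    mean (fun s : {perm T} => \sum_r' h (s p1) r' - h (s p1) (s p1)).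
  rewrite /mean mulrCA; congr (_ * _).
  rewrite -natT mulr_natl -cardT -sumr_const.
  rewrite -(eq_bigr _ shift) exchange_big /=.
  apply: eq_bigr => s _.
  by rewrite [X in _ = X - _](reindex_inj (@perm_inj _ s)) /=
    [X in _ = X - _](bigD1 p1)//= addrC addrK.
apply: (mulfI T10); rewrite key.
rewrite (mean_perm1 (fun r => \sum_r' h r r' - h r r)) /mean sumrB /=.
by field; rewrite T0 T10.
Qed.

(** [mean_perm2] for the columns with the rows fixed, and then for the rows: the
    result of the first step depends on the rows only through [s p1] and
    [s p2]. *)
Lemma mean_perm_pair {R : realType} {T U : finType} (F G : T -> U -> R)
    (p1 p2 : T) (q1 q2 : U) :
  (1 < #|T|)%N -> (1 < #|U|)%N -> \sum_r \sum_c F r c = 0 ->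
  mean (fun x : {perm T} * {perm U} =>
          F (x.1 p1) (x.2 q1) * G (x.1 p2) (x.2 q2)) =
  (#|T|%:R * (#|T|%:R - 1) * (#|U|%:R * (#|U|%:R - 1)))^-1 *
  ((#|T|%:R * (p1 == p2)%:R - 1) * (#|U|%:R * (q1 == q2)%:R - 1) *
     (\sum_r \sum_c F r c * G r c)
   + (#|T|%:R * (p1 == p2)%:R - 1) * (1 - (q1 == q2)%:R) *
     (\sum_r (\sum_c F r c) * (\sum_c G r c))
   + (1 - (p1 == p2)%:R) * (#|U|%:R * (q1 == q2)%:R - 1) *
     (\sum_c (\sum_r F r c) * (\sum_r G r c))).
Proof.
move=> T1 U1 F0.
rewrite (mean_pair (fun (s : {perm T}) (t : {perm U}) =>
  F (s p1) (t q1) * G (s p2) (t q2))).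
under eq_mean => s do
  rewrite (mean_perm2 (fun c c' => F (s p1) c * G (s p2) c') q1 q2 U1).
rewrite (mean_perm2 (fun r r' => (#|U|%:R * (#|U|%:R - 1))^-1 *
  ((#|U|%:R * (q1 == q2)%:R - 1) * \sum_c F r c * G r' c
   + (1 - (q1 == q2)%:R) * \sum_c \sum_c' F r c * G r' c')) p1 p2 T1).
rewrite [in RHS]invfM -[RHS]mulrA; congr (_ * _).
have pull (k x y : R) (f g : T -> R) :
    \sum_r k * (x * f r + y * g r) = k * (x * \sum_r f r + y * \sum_r g r).
  by rewrite -mulr_sumr big_split /= !mulr_sumr.
rewrite (pull _ _ _ (fun r => \sum_c F r c * G r c)
                    (fun r => \sum_c \sum_c' F r c * G r c')).
under [X in _ + _ * X = _]eq_bigr => r _ do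
  rewrite (pull _ _ _ (fun r' => \sum_c F r c * G r' c)
                      (fun r' => \sum_c \sum_c' F r c * G r' c')).
rewrite (pull _ _ _ (fun r => \sum_r' \sum_c F r c * G r' c)
                    (fun r => \sum_r' \sum_c \sum_c' F r c * G r' c')).
have prod_sum (f g : U -> R) :
    \sum_c \sum_c' f c * g c' = (\sum_c f c) * (\sum_c g c).
  by rewrite mulr_suml; apply: eq_bigr => c _; rewrite mulr_sumr.
have -> : \sum_r \sum_c \sum_c' F r c * G r c' =
    \sum_r (\sum_c F r c) * (\sum_c G r c).
  by apply: eq_bigr => r _; rewrite prod_sum.
have -> : \sum_r \sum_r' \sum_c \sum_c' F r c * G r' c' = 0.
  under eq_bigr => r _ do
    (under eq_bigr => r' _ do rewrite prod_sum; rewrite -mulr_sumr).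
  by rewrite -mulr_suml F0 mul0r.
have -> : \sum_r \sum_r' \sum_c F r c * G r' c =
    \sum_c (\sum_r F r c) * (\sum_r G r c).
  under eq_bigr => r _ do rewrite exchange_big /=.
  rewrite exchange_big /=; apply: eq_bigr => c _.
  by rewrite mulr_suml; apply: eq_bigr => r _; rewrite mulr_sumr.
ring.
Qed.

(** * The analysis of variance identity *)

(** The residuals [E] of [G] have zero row and column sums, hence are orthogonal
    to the row and column means of [F].  On the left [F] may thus replace its
    residuals; summing the row and column means in [E] against [F] then only
    involves the row and column totals of [F]. *)
Lemma interaction_sum {R : realType} {T U : finType} (F G : T -> U -> R) :
  (0 < #|T|)%N -> (0 < #|U|)%N ->
  \sum_r \sum_c F r c = 0 -> \sum_r \sum_c G r c = 0 ->
  \sum_r \sum_c (F r c - mean (F r) - mean (F^~ c)) *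
                 (G r c - mean (G r) - mean (G^~ c)) =
  \sum_r \sum_c F r c * G r c
  - #|U|%:R * \sum_r mean (F r) * mean (G r)
  - #|T|%:R * \sum_c mean (F^~ c) * mean (G^~ c).
Proof.
move=> T_gt0 U_gt0 F0 G0.
have sum_mean (S : finType) (f : S -> R) :
    (0 < #|S|)%N -> \sum_s f s = #|S|%:R * mean f.
  by move=> S_gt0; rewrite /mean mulVKf// pnatr_eq0 -lt0n.
have sum_cst (S : finType) (x : R) : \sum_(s : S) x = #|S|%:R * x.
  by rewrite sumr_const mulr_natl.
have sum_row (H : T -> U -> R) :
    \sum_r \sum_c H r c = 0 -> \sum_r mean (H r) = 0.
  by move=> H0; rewrite -mulr_sumr H0 mulr0.
have sum_col (H : T -> U -> R) :
    \sum_r \sum_c H r c = 0 -> \sum_c mean (H^~ c) = 0.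
  by move=> H0; rewrite -mulr_sumr exchange_big H0 mulr0.
pose E r c := G r c - mean (G r) - mean (G^~ c).
have Erow r : \sum_c E r c = 0.
  by rewrite !sumrB sum_cst (sum_col _ G0) (sum_mean _ _ U_gt0) subr0 subrr.
have Ecol c : \sum_r E r c = 0.
  by rewrite !sumrB sum_cst (sum_row _ G0) (sum_mean _ _ T_gt0) subr0 subrr.
have -> : \sum_r \sum_c (F r c - mean (F r) - mean (F^~ c)) * E r c =
    \sum_r \sum_c F r c * E r c.
  under eq_bigr => r _.
    under eq_bigr => c _ do rewrite 2!mulrBl.
    rewrite 2!sumrB -mulr_sumr Erow mulr0 subr0.
    over.
  rewrite sumrB exchange_big /= [X in _ - X]exchange_big /=.
  rewrite [X in _ - X]big1 ?subr0 1?exchange_big//= => c _.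
  by rewrite -mulr_sumr Ecol mulr0.
under eq_bigr => r _.
  under eq_bigr => c _ do rewrite 2!mulrBr.
  rewrite 2!sumrB -mulr_suml (sum_mean _ (F r) U_gt0) -mulrA.
  over.
rewrite 2!sumrB -mulr_sumr; congr (_ - _).
rewrite exchange_big mulr_sumr /=; apply: eq_bigr => c _.
by rewrite -mulr_suml (sum_mean _ (F^~ c) T_gt0) mulrA.
Qed.

(** * From the randomization to averages *)

(** [g \o X] is a finite combination of indicators of the fibres of [X]. *)
Lemma uniform_expectation {d} {Omega : measurableType d} {R : realType}
    {Pr : probability Omega R} {S : finType} (X : Omega -> S) (g : S -> R) :
  uniformly_distributed Pr X ->
  expectation Pr (fun w => g (X w)) = (mean g)%:E.
Proof.
move=> [mX PrX]; rewrite unlock.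
have gX w : (g (X w))%:E =
    (\sum_(s : S) (g s)%:E * (\1_(X @^-1` [set s]) w)%:E)%E.
  rewrite sumEFin; congr EFin; rewrite (bigD1 (X w))//= indicE mem_set//= mulr1.
  rewrite big1 ?addr0// => s sX; rewrite indicE memNset ?mulr0//=.
  by move=> Xs; move: sX; rewrite Xs eqxx.
under eq_integral do rewrite gX.
rewrite integral_sum//=; last first.
  by move=> s; apply: integrableZl => //; exact: integrable_indic.
rewrite /mean mulrC mulr_suml -sumEFin; apply: eq_bigr => s _.
rewrite integralZl//; last exact: integrable_indic.
by rewrite EFinM -(PrX s) integral_indic// setIT.
Qed.

Lemma uniform_covariance {d} {Omega : measurableType d} {R : realType}
    {Pr : probability Omega R} {S : finType} (X : Omega -> S) (f g : S -> R) :
  uniformly_distributed Pr X ->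
  covariance Pr (fun w => f (X w)) (fun w => g (X w)) =
  (mean (fun s => (f s - mean f) * (g s - mean g)))%:E.
Proof.
move=> uX; rewrite unlock !(uniform_expectation _ _ uX) /=.
exact: (uniform_expectation _ (fun s => (f s - mean f) * (g s - mean g)) uX).
Qed.

(** The product rule is applied to singletons in block [b] and to full sets in
    the other blocks, whose factors are then 1. *)
Lemma block_uniform {d} {Omega : measurableType d} {R : realType}
    {Pr : probability Omega R} {B P Q : nat}
    {rho : 'I_B -> Omega -> 'S_P} {kappa : 'I_B -> Omega -> 'S_Q} (b : 'I_B) :
  strip_plot_randomization Pr rho kappa ->
  uniformly_distributed Pr (fun w => (rho b w, kappa b w)).
Proof.
move=> [urho ukappa indep].
have preE s t : (fun w => (rho b w, kappa b w)) @^-1` [set (s, t)] =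
    rho b @^-1` [set s] `&` kappa b @^-1` [set t] :> set Omega.
  by apply/seteqP; split => w /= [-> ->].
split=> -[s t]; rewrite preE.
  by apply: measurableI; apply: uniform_measurable.
have := indep (fun b' => if b' == b then [set s] else setT)
              (fun b' => if b' == b then [set t] else setT).
have -> : \bigcap_(b' in [set: 'I_B])
      (rho b' @^-1` (if b' == b then [set s] else setT) `&`
       kappa b' @^-1` (if b' == b then [set t] else setT)) =
    rho b @^-1` [set s] `&` kappa b @^-1` [set t].
  apply/seteqP; split => [w /(_ b I)|w bw b' _]; first by rewrite eqxx.
  by case: eqVneq => [->|//].
move=> ->; rewrite (bigD1 b)//= big1 ?mule1 => [|b' /negbTE ->].
  by rewrite eqxx !uniform_mass// card_prod natrM invfM EFinM.
by rewrite !preimage_setT probability_setT mule1.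
Qed.

Lemma mean_observed {R : realType} {B P Q : nat} (Y : outcomes R B P Q)
    (b : 'I_B) (p : 'I_P) (q : 'I_Q) :
  mean (fun x : 'S_P * 'S_Q => Y b (x.1 p) (x.2 q) p q) = Ybar Y b p q.
Proof.
rewrite (mean_pair (fun (s : 'S_P) (t : 'S_Q) => Y b (s p) (t q) p q)).
under eq_mean => s do rewrite (mean_perm1 (fun c => Y b (s p) c p q)).
rewrite (mean_perm1 (fun r => mean (fun c => Y b r c p q))).
by rewrite /mean /Ybar !card_ord invfM -mulrA -mulr_sumr.
Qed.

(** * The covariance of the observed outcomes *)

Theorem theorem1 (R : realType) (d : measure_display)
    (Omega : measurableType d) (Pr : probability Omega R)
    (B P Q : nat) (hB : (2 <= B)%N) (hP : (2 <= P)%N) (hQ : (2 <= Q)%N)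
    (Y : outcomes R B P Q)
    (rho : 'I_B -> Omega -> 'S_P) (kappa : 'I_B -> Omega -> 'S_Q)
    (hrand : strip_plot_randomization Pr rho kappa)
    (b : 'I_B) (p1 p2 : 'I_P) (q1 q2 : 'I_Q) :
  covariance Pr (Yobs Y rho kappa b p1 q1) (Yobs Y rho kappa b p2 q2) =
  ((P%:R * Q%:R)^-1 *
   ((P%:R * kronecker R p1 p2 - 1) * M_row Y b p1 q1 p2 q2
    + (Q%:R * kronecker R q1 q2 - 1) * M_col Y b p1 q1 p2 q2
    + (P%:R * kronecker R p1 p2 - 1) * (Q%:R * kronecker R q1 q2 - 1)
      * M_rowcol Y b p1 q1 p2 q2))%:E.
Proof.
have P0 : P%:R != 0 :> R by rewrite pnatr_eq0 -lt0n ltnW.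
have Q0 : Q%:R != 0 :> R by rewrite pnatr_eq0 -lt0n ltnW.
have P10 : P%:R - 1 != 0 :> R by rewrite subr_eq0 pnatr_eq1 gtn_eqF.
have Q10 : Q%:R - 1 != 0 :> R by rewrite subr_eq0 pnatr_eq1 gtn_eqF.
apply: eq_trans (uniform_covariance (fun w => (rho b w, kappa b w))
  (fun x => Y b (x.1 p1) (x.2 q1) p1 q1) (fun x => Y b (x.1 p2) (x.2 q2) p2 q2)
  (block_uniform b hrand)) _.
rewrite !mean_observed; congr EFin.
(* The arrays of outcomes, centred as required by mean_perm_pair. *)
pose F p q r c := Y b r c p q - Ybar Y b p q.
have rowE p q r : mean (F p q r) = Ybar_row Y b r p q - Ybar Y b p q.
  by rewrite /mean card_ord sumrB sumr_const card_ord mulrBr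
    -(mulr_natl (Ybar Y b p q)) mulKf.
have colE p q c : mean ((F p q)^~ c) = Ybar_col Y b c p q - Ybar Y b p q.
  by rewrite /mean card_ord sumrB sumr_const card_ord mulrBr
    -(mulr_natl (Ybar Y b p q)) mulKf.
have rowS p q r : \sum_c F p q r c = Q%:R * (Ybar_row Y b r p q - Ybar Y b p q).
  by rewrite -rowE /mean card_ord mulVKf.
have colS p q c : \sum_r F p q r c = P%:R * (Ybar_col Y b c p q - Ybar Y b p q).
  by rewrite -colE /mean card_ord mulVKf.
have F0 p q : \sum_r \sum_c F p q r c = 0.
  under eq_bigr => r _ do
    rewrite sumrB sumr_const card_ord -(mulr_natl (Ybar Y b p q)).
  rewrite sumrB sumr_const card_ord -(mulr_natl (Q%:R * _)) mulrA /Ybar.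
  rewrite mulVKf ?subrr//.
  by rewrite mulf_neq0.
have DE p q r c :
    D Y b r c p q = F p q r c - mean (F p q r) - mean ((F p q)^~ c).
  by rewrite rowE colE /D /F; ring.
rewrite (mean_perm_pair (F p1 q1) (F p2 q2)) ?card_ord//.
have -> : M_rowcol Y b p1 q1 p2 q2 = ((P%:R - 1) * (Q%:R - 1))^-1 *
    (\sum_r \sum_c F p1 q1 r c * F p2 q2 r c
     - Q%:R * \sum_r mean (F p1 q1 r) * mean (F p2 q2 r)
     - P%:R * \sum_c mean ((F p1 q1)^~ c) * mean ((F p2 q2)^~ c)).
  congr (_ * _); have := interaction_sum (F p1 q1) (F p2 q2).
  rewrite !card_ord => <-; rewrite ?F0 ?(ltnW hP) ?(ltnW hQ)//.
  by apply: eq_bigr => r _; apply: eq_bigr => c _; rewrite !DE.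
have -> : \sum_r (\sum_c F p1 q1 r c) * (\sum_c F p2 q2 r c) =
    Q%:R ^+ 2 * \sum_r mean (F p1 q1 r) * mean (F p2 q2 r).
  by rewrite mulr_sumr; apply: eq_bigr => r _; rewrite !rowE !rowS; ring.
have -> : \sum_c (\sum_r F p1 q1 r c) * (\sum_r F p2 q2 r c) =
    P%:R ^+ 2 * \sum_c mean ((F p1 q1)^~ c) * mean ((F p2 q2)^~ c).
  by rewrite mulr_sumr; apply: eq_bigr => c _; rewrite !colE !colS; ring.
have -> : M_row Y b p1 q1 p2 q2 = Q%:R / (P%:R - 1) *
    \sum_r mean (F p1 q1 r) * mean (F p2 q2 r).
  by congr (_ * _); apply: eq_bigr => r _; rewrite !rowE.
have -> : M_col Y b p1 q1 p2 q2 = P%:R / (Q%:R - 1) *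
    \sum_c mean ((F p1 q1)^~ c) * mean ((F p2 q2)^~ c).
  by congr (_ * _); apply: eq_bigr => c _; rewrite !colE.
rewrite /kronecker; field.
by rewrite P0 Q0 P10 Q10.
Qed.
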